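(* Let $N,T\ge1$ be integers and $\alpha\in(0,1)$. Suppose the base station uses the uniformly random scheduling algorithm. Then for every feasible blocking matrix $\sigma$, $$\frac1T\sum_{t=1}^T\frac1N\sum_{i=1}^N\mathbb{E}[a_i(t)]\ \le\ \frac{T+1}{2N}+(N-1).$$
   Context: A base station serves $N$ users over time slots $1,\dots,T$. A blocking matrix is $\sigma\in\{0,1\}^{N\times T}$, chosen by an adversary in advance; $\sigma_i(t)=0$ means user $i$ is blocked in slot $t$, and $\sigma_i(t)=1$ means it is not. It is feasible if $\sum_{i=1}^N\sum_{t=1}^T(1-\sigma_i(t))\le\alpha T$ and $\sum_{i=1}^N(1-\sigma_i(t))\le 1$ for each $t$. Uniformly random scheduling algorithm: in each slot $t$, independently of everything else, the base station chooses one user uniformly at random (each with probability $1/N$). Age process: $a_i(1)=1$; $a_i(t+1)=1$ if user $i$ is chosen in slot $t$ and $\sigma_i(t)=1$; otherwise $a_i(t+1)=a_i(t)+1$. *)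

(* Defs.v *)
(* MathComp + MathComp-Analysis. *)
From HB Require Import structures.
From mathcomp Require Import all_boot all_order all_algebra.
From mathcomp Require Import all_classical all_reals all_analysis.
Set Implicit Arguments.
Unset Strict Implicit.
Unset Printing Implicit Defensive.
Import Order.TTheory GRing.Theory Num.Theory.
Local Open Scope classical_set_scope.
Local Open Scope ring_scope.

(* The ordinal [t : 'I_T] stands for the time slot t + 1 of {1, ..., T}, and
   [sigma i t = false] (that is, sigma_i = 0) means that user i is blocked. *)

Definition feasible (R : realType) (N T : nat) (alpha : R)
    (sigma : 'M[bool]_(N, T)) : Prop :=
  (\sum_(i < N) \sum_(t < T) (1 - sigma i t)%N)%N%:R <= alpha * T%:R /\
  forall t : 'I_T, (\sum_(i < N) (1 - sigma i t) <= 1)%N.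

(* [c t] is the user chosen in slot t.  [age sigma c i k] is the age a_i(k + 1),
   so that the age of user i in the slot denoted by [t : 'I_T] is
   [age sigma c i t].  The existential only turns the number k into the ordinal
   with that value. *)
Fixpoint age (N T : nat) (sigma : 'M[bool]_(N, T)) (c : 'I_T -> 'I_N)
    (i : 'I_N) (k : nat) : nat :=
  if k is k'.+1 then
    if [exists t : 'I_T, [&& val t == k', c t == i & sigma i t]] then 1%N
    else (age sigma c i k').+1
  else 1%N.

(* Mutual independence of finitely many random variables with values in a finite
   type, every subset of which is an event. *)
Definition mutually_independent (d : measure_display) (Omega : measurableType d)
    (R : realType) (P : probability Omega R) (I E : finType)
    (X : I -> Omega -> E) : Prop :=
  forall (J : {set I}) (B : I -> set E),
    P (\bigcap_(j in [set` J]) X j @^-1` B j) =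
    (\prod_(j in J) P (X j @^-1` B j))%E.

(* [sigma] being a constant, independence from everything else amounts to
   independence across slots. *)
Record uniform_scheduling (d : measure_display) (Omega : measurableType d)
    (R : realType) (P : probability Omega R) (N T : nat)
    (c : 'I_T -> Omega -> 'I_N) : Prop := UniformScheduling {
  choice_measurable :
    forall (t : 'I_T) (i : 'I_N), measurable (c t @^-1` [set i]);
  choice_uniform :
    forall (t : 'I_T) (i : 'I_N), P (c t @^-1` [set i]) = (N%:R^-1)%:E;
  choice_independent : mutually_independent P c }.

(* Main.v *)
(* Number the slots from 0.  After k slots the age of user i is the number of
   j <= k such that i is not served in the slots j, ..., k - 1.  By independence
   its mean is a sum of products of probabilities of not being served, so it
   satisfies A(k+1) = 1 + q_k A(k), with q_k = 1 - 1/N in an unblocked slot and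
   q_k = 1 in a blocked one.  As at most one user is blocked in each slot,
   induction on k gives sum_i A_i(k) <= k + 1 + N (N - 1).  The extremal case is
   one user always blocked, of age k + 1, and N - 1 users of mean age near N. *)
Require Import Defs.
From HB Require Import structures.
From mathcomp Require Import all_boot all_order all_algebra.
From mathcomp Require Import all_classical all_reals all_analysis.
From mathcomp Require Import measurable_realfun ring lra.
Set Implicit Arguments.
Unset Strict Implicit.
Unset Printing Implicit Defensive.
Import Order.TTheory GRing.Theory Num.Theory.
Local Open Scope classical_set_scope.
Local Open Scope ring_scope.

Definition slots (T j k : nat) : {set 'I_T} := [set t : 'I_T | (j <= t < k)%N]%SET.

Lemma slotsnn (T k : nat) : slots T k k = finset.set0.
Proof. by apply/setP => t; rewrite !inE; case: ltngtP. Qed.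

Lemma slotsS (T j : nat) (t : 'I_T) :
  (j <= t)%N -> slots T j t.+1 = (t |: slots T j t)%SET.
Proof.
move=> jt; apply/setP => s; rewrite !inE ltnS.
have [->|nst] := eqVneq s t; first by rewrite jt leqnn.
by rewrite (leq_eqVlt s) (inj_eq val_inj) (negbTE nst).
Qed.

Definition unserved (N T : nat) (sigma : 'M[bool]_(N, T)) (c : 'I_T -> 'I_N)
    (i : 'I_N) (A : {set 'I_T}) : bool :=
  [forall t in A, ~~ ((c t == i) && sigma i t)].

Lemma unservedP (N T : nat) (sigma : 'M[bool]_(N, T)) (c : 'I_T -> 'I_N)
    (i : 'I_N) (A : {set 'I_T}) :
  reflect (forall t, t \in A -> ~~ ((c t == i) && sigma i t))
          (unserved sigma c i A).
Proof. exact: forall_inP. Qed.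

(** Induction on [k]. A service in slot [k] kills every term with [j <= k] and leaves only the empty
    range [j = k + 1], so the sum resets to 1. Without one, the old terms keep their values and the
    empty range adds 1. *)
Lemma age_sum_unserved (N T : nat) (sigma : 'M[bool]_(N, T))
    (c : 'I_T -> 'I_N) (i : 'I_N) (k : nat) :
  age sigma c i k = (\sum_(j < k.+1) unserved sigma c i (slots T j k))%N.
Proof.
have U0 : unserved sigma c i finset.set0 by apply/unservedP => t; rewrite inE.
elim: k => [|k IH].
  by rewrite big_ord1 slotsnn U0.
rewrite big_ord_recr /= slotsnn U0.
case: existsP => [[t /and3P[/eqP tk ct st]]|H].
  rewrite big1 // => j _; apply/eqP; rewrite eqb0; apply/unservedP => /(_ t).
  by rewrite inE ct st tk ltnSn -ltnS ltn_ord => /(_ isT).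
rewrite IH addn1; congr _.+1; apply: eq_bigr => j _; congr nat_of_bool.
apply/unservedP/unservedP => U t; rewrite inE => /andP[jt tk].
  have [e|ne] := eqVneq (val t) k; last first.
    by apply: U; rewrite inE jt ltn_neqAle ne -ltnS.
  by apply/negP => /andP[ct st]; apply: H; exists t; rewrite e eqxx ct st.
by apply: U; rewrite inE jt (leqW tk).
Qed.

Definition miss_prob (R : realType) (N T : nat) (sigma : 'M[bool]_(N, T))
    (i : 'I_N) (t : 'I_T) : R := 1 - (sigma i t)%:R / N%:R.

(** Closed form of the expected age: each product is the probability that [i] goes unserved in the
    slots [j], ..., [k - 1]. *)
Definition mean_age (R : realType) (N T : nat) (sigma : 'M[bool]_(N, T))
    (i : 'I_N) (k : nat) : R :=
  \sum_(j < k.+1) \prod_(t in slots T j k) miss_prob R sigma i t.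

Section MeanAge.
Context {R : realType} {N T : nat}.
Variable sigma : 'M[bool]_(N, T).

Lemma miss_prob_itv (i : 'I_N) (t : 'I_T) : 0 <= miss_prob R sigma i t <= 1.
Proof.
have N1 : 1 <= N%:R :> R by rewrite ler1n (leq_trans _ (ltn_ord i)).
rewrite /miss_prob; case: (sigma i t) => /=; last by rewrite mul0r subr0 ler01 lexx.
by rewrite mul1r subr_ge0 gerBl invr_ge0 ler0n andbT invf_le1 ?(lt_le_trans ltr01).
Qed.

Lemma mean_age0 (i : 'I_N) : mean_age R sigma i 0 = 1.
Proof. by rewrite /mean_age big_ord1 slotsnn big_set0. Qed.

(** Slot [t] lies in every range ending at [t.+1] except the empty one, so its factor comes out of
    all terms but a single 1. *)
Lemma mean_ageS (i : 'I_N) (t : 'I_T) :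
  mean_age R sigma i t.+1 = 1 + miss_prob R sigma i t * mean_age R sigma i t.
Proof.
rewrite /mean_age big_ord_recr /= slotsnn big_set0 addrC mulr_sumr.
congr (_ + _); apply: eq_bigr => j _.
by rewrite slotsS ?leq_ord // big_setU1 //= inE ltnn andbF.
Qed.

Lemma mean_age_itv (i : 'I_N) (k : nat) : 0 <= mean_age R sigma i k <= k.+1%:R.
Proof.
have q01 := miss_prob_itv i.
apply/andP; split.
  by apply: sumr_ge0 => j _; apply: prodr_ge0 => t _; case/andP: (q01 t).
rewrite -[k.+1 in leRHS]card_ord -sumr_const.
by apply: ler_sum => j _; apply: prodr_ile1 => t; rewrite q01.
Qed.

(** [b] is the blocked user if there is one, and an arbitrary user otherwise. *)
Lemma at_most_one_blocked (t : 'I_T) :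
  (0 < N)%N -> (\sum_(i < N) (1 - sigma i t) <= 1)%N ->
  exists b : 'I_N, forall i, i != b -> sigma i t.
Proof.
move=> N0 le1; have [b sb|s1] := pickP (fun i => ~~ sigma i t); last first.
  by exists (Ordinal N0) => i _; move/negbFE: (s1 i).
exists b => i ib; apply: contraTT le1 => si.
by rewrite (bigD1 b) //= (bigD1 i) //= (negbTE sb) (negbTE si) -ltnNge.
Qed.

Lemma sum_mean_age (k : nat) : (0 < N)%N ->
  (forall t : 'I_T, (\sum_(i < N) (1 - sigma i t) <= 1)%N) -> (k <= T)%N ->
  \sum_(i < N) mean_age R sigma i k <= k.+1%:R + N%:R * (N%:R - 1).
Proof.
move=> N0 blk; have N1 : 1 <= N%:R :> R by rewrite ler1n.
elim: k => [_|k IH kT].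
  rewrite (eq_bigr (fun=> 1)) => [|i _]; last exact: mean_age0.
  (* [N <= 1 + N (N - 1)] amounts to [(N - 1)^2 >= 0]. *)
  by rewrite sumr_const card_ord; nra.
pose t := Ordinal kT; have [b hb] := at_most_one_blocked N0 (blk t).
move: (IH (ltnW kT)) => {}IH; rewrite (bigD1 b) //= in IH; rewrite (bigD1 b) //=.
set U := \sum_(i < N | i != b) mean_age R sigma i k in IH *.
(* The users other than [b] share the factor [1 - 1/N], so their total obeys a scalar recursion. *)
have -> : \sum_(i < N | i != b) mean_age R sigma i k.+1
    = (N%:R - 1) + (1 - N%:R^-1) * U.
  rewrite mulr_sumr (eq_bigr (fun i => 1 + (1 - N%:R^-1) * mean_age R sigma i k)).
    rewrite big_split /= sumr_const; congr (_ + _).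
    by rewrite cardC1 card_ord -subn1 natrB.
  by move=> i ib; rewrite (mean_ageS i t) /miss_prob hb // mul1r.
rewrite (mean_ageS b t) -[nat_of_ord t]/k.
have /andP[A0 A1] := mean_age_itv b k; have /andP[_ q1] := miss_prob_itv b t.
(* This bound covers [b] whether blocked or not. *)
have qA := ler_piMl A0 q1.
have e : N%:R * N%:R^-1 = 1 :> R by rewrite mulfV // gt_eqF // (lt_le_trans ltr01).
have v0 : 0 <= N%:R^-1 :> R by rewrite invr_ge0 ler0n.
have v1 : N%:R^-1 <= 1 :> R by rewrite invf_le1 ?(lt_le_trans ltr01).
rewrite -[k.+2]addn1 natrD.
(* If U >= N (N - 1), the drift of the total age is at most N - U / N <= 1, and
   the induction hypothesis suffices; otherwise A_b(k) <= k + 1 does. *)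
have [UN|/ltW UN] := leP (N%:R * (N%:R - 1)) U.
  have := ler_wpM2r v0 UN; rewrite mulrAC e; nra.
(* [N (N - 1)] is the fixed point of [x |-> (N - 1) + (1 - 1/N) x], so the total of the others stays
   below it. *)
have e2 : (1 - N%:R^-1) * (N%:R * (N%:R - 1)) = (N%:R - 1) * (N%:R - 1) :> R.
  by rewrite mulrA mulrBl mul1r [_^-1 * _]mulrC e.
have w0 : 0 <= 1 - N%:R^-1 :> R by rewrite subr_ge0.
have := ler_wpM2l w0 UN; rewrite e2; lra.
Qed.

End MeanAge.

Section Expectation.
Context {d : measure_display} {Omega : measurableType d} {R : realType}.
Variable P : probability Omega R.
Context {N T : nat}.
Variables (c : 'I_T -> Omega -> 'I_N) (hc : uniform_scheduling P c).
Variable sigma : 'M[bool]_(N, T).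

(** A set of users rather than of outcomes, the form in which [mutually_independent] takes its
    events. *)
Let miss (i : 'I_N) (t : 'I_T) : set 'I_N :=
  [set u | ~~ ((u == i) && sigma i t)].

Let measurable_miss (i : 'I_N) (t : 'I_T) : measurable (c t @^-1` miss i t).
Proof.
rewrite /miss; case: (sigma i t).
  rewrite (_ : _ @^-1` _ = ~` (c t @^-1` [set i])).
    exact/measurableC/(choice_measurable hc).
  by apply/seteqP; split => w /=; rewrite andbT => /eqP.
rewrite (_ : _ @^-1` _ = setT); first exact: measurableT.
by apply/seteqP; split => w //= _; rewrite andbF.
Qed.

Let prob_miss (i : 'I_N) (t : 'I_T) :
  P (c t @^-1` miss i t) = (miss_prob R sigma i t)%:E.
Proof.
rewrite /miss /miss_prob; case: (sigma i t).
  rewrite (_ : _ @^-1` _ = ~` (c t @^-1` [set i])).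
    rewrite probability_setC; last exact: (choice_measurable hc).
    by rewrite (choice_uniform hc) mul1r.
  by apply/seteqP; split => w /=; rewrite andbT => /eqP.
rewrite (_ : _ @^-1` _ = setT); first by rewrite probability_setT mul0r subr0.
by apply/seteqP; split => w //= _; rewrite andbF.
Qed.

Let unserved_event (i : 'I_N) (A : {set 'I_T}) : set Omega :=
  \bigcap_(t in [set` A]) c t @^-1` miss i t.

Lemma expectation_age (i : 'I_N) (k : nat) :
  ('E_P[fun w => (age sigma (fun s => c s w) i k)%:R]
    = (mean_age R sigma i k)%:E)%E.
Proof.
rewrite unlock.
(* The age becomes a sum of indicators, whose integrals are probabilities of intersections over
   slots; independence then factors these. *)
under eq_integral => w _.
  rewrite age_sum_unserved natr_sum -sumEFin.
  under eq_bigr => j _.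
    rewrite (_ : _%:R = \1_(unserved_event i (slots T j k)) w); last first.
      rewrite indicE; congr (nat_of_bool _)%:R.
      apply/unservedP/idP; first by move=> U; apply/mem_set => t; exact: U.
      by move/set_mem => U t; exact: U.
    over.
  over.
have mE (A : {set 'I_T}) : measurable (unserved_event i A).
  by apply: fin_bigcap_measurable => // t _; exact: measurable_miss.
rewrite ge0_integral_sum //; last first.
  by move=> j; apply/measurable_EFinP; exact: measurable_indic.
rewrite /mean_age -sumEFin; apply: eq_bigr => j _.
rewrite integral_indic // setIT -prodEFin.
rewrite [LHS](choice_independent hc (slots T j k) (miss i)).
by apply: eq_bigr => t _; exact: prob_miss.
Qed.

End Expectation.

Theorem theorem2 (R : realType) (d : measure_display)
    (Omega : measurableType d) (P : probability Omega R)
    (N T : nat) (hN : (1 <= N)%N) (hT : (1 <= T)%N)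
    (alpha : R) (halpha : 0 < alpha < 1)
    (c : 'I_T -> Omega -> 'I_N) (hc : uniform_scheduling P c)
    (sigma : 'M[bool]_(N, T)) (hsigma : feasible alpha sigma) :
  ((T%:R^-1)%:E *
     (\sum_(t < T) ((N%:R^-1)%:E *
        (\sum_(i < N)
           'E_P[fun w => (age sigma (fun s => c s w) i t)%:R])))
   <= (((T + 1)%:R / (2 * N%:R)) + (N%:R - 1))%:E)%E.
Proof.
case: hsigma => _ blk.
have N0 : N%:R != 0 :> R by rewrite pnatr_eq0 -lt0n.
have T0 : T%:R != 0 :> R by rewrite pnatr_eq0 -lt0n.
under eq_bigr => t _.
  under eq_bigr => i _ do rewrite (expectation_age hc sigma).
  rewrite sumEFin -EFinM; over.
rewrite sumEFin -EFinM lee_fin -mulr_sumr.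
have sumS n : \sum_(t < n) t.+1%:R = n%:R * (n%:R + 1) / 2 :> R.
  by elim: n => [|n IH]; rewrite ?big_ord0 ?mul0r // big_ord_recr /= IH -natr1; field.
(* The right side is the average over [t] of [(t + 1 + N (N - 1)) / N], which allows a comparison
   slot by slot. *)
rewrite (_ : _ + _ = T%:R^-1 * (N%:R^-1 *
    \sum_(t < T) (t.+1%:R + N%:R * (N%:R - 1)))).
  do 2 (apply: ler_wpM2l; first by rewrite invr_ge0 ler0n).
  by apply: ler_sum => t _; apply: sum_mean_age => //; exact: ltnW.
rewrite big_split /= sumS sumr_const card_ord -mulr_natl natrD.
by field; rewrite N0 T0.
Qed.
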